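(* Let $\Lambda=[a,b]$ be a ring with $|\Lambda|\geq 4$. The following hold for the ground-state space $\mathcal{G}_\Lambda^{\mathrm{per}}$. 1. The set of periodic VMD-states $\{\psi_\Lambda^{\mathrm{per}}(R)\,|\,R\in\mathcal{R}_\Lambda^{\mathrm{per}}\}$ is an orthogonal basis of $\mathcal{G}_\Lambda^{\mathrm{per}}$, where $$\psi_\Lambda^{\mathrm{per}}(R)=\sum_{T\in\mathcal{T}_\Lambda^{\mathrm{per}}(R)}\left(\frac{\lambda}{\sqrt2}\right)^{d(T)}|\sigma_\Lambda(T)\rangle$$ and $d(T)$ is the number of dimers $D$ in the periodic tiling $T$. 2. There are constants $c,C>0$ independent of $\Lambda$ such that $$c\,\mu_+^{|\Lambda|}\leq\dim\mathcal{G}_\Lambda^{\mathrm{per}}\leq C\,\mu_+^{|\Lambda|},\qquad \mu_+:=\frac{1+\sqrt5}{2}.$$ 3. For any periodic root tiling $R\in\mathcal{R}_\Lambda^{\mathrm{per}}$, $N_\Lambda\psi_\Lambda^{\mathrm{per}}(R)=N_\Lambda(R)\,\psi_\Lambda^{\mathrm{per}}(R)$, where $N_\Lambda=\sum_{x\in\Lambda}n_x$ is the particle number operator and $N_\Lambda(R)$ is the number of particles in $R$. Moreover, $$\frac12-\frac{1}{2|\Lambda|}\leq\max_{R\in\mathcal{R}_\Lambda^{\mathrm{per}}}\frac{N_\Lambda(R)}{|\Lambda|}\leq\frac12 .$$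
   Context: Standing assumptions: $\kappa>0$, $\lambda\in\mathbb{C}\setminus\{0\}$. Hamiltonian. For a finite interval $\Lambda=[a,b]=\{a,\dots,b\}\subset\mathbb{Z}$, $|\Lambda|=b-a+1$, viewed as a ring (site labels modulo $|\Lambda|$), let $\mathcal{H}_\Lambda=\ell^2(\mathbb{N}_0^\Lambda)$ with orthonormal basis $|\mu\rangle$, $\mu\in\mathbb{N}_0^\Lambda$, $\psi=\sum_\mu\psi(\mu)|\mu\rangle$, and $n_x|\mu\rangle=\mu_x|\mu\rangle$. With $\delta_x$ the configuration having a single particle at $x$, $$(q_x\psi)(\nu)=\sqrt{(\nu_x+1)(\nu_x+2)}\,\psi(\nu+2\delta_x)-\lambda\sqrt{(\nu_{x-1}+1)(\nu_{x+1}+1)}\,\psi(\nu+\delta_{x-1}+\delta_{x+1}).$$ $H_\Lambda^{\mathrm{per}}$ is the non-negative self-adjoint operator associated (Friedrichs extension from finite linear combinations of the $|\mu\rangle$) with $$\langle\psi|H_\Lambda^{\mathrm{per}}\psi\rangle=\sum_{\mu}\Big(\sum_{x=a}^{b}\mu_x\mu_{x+1}\Big)|\psi(\mu)|^2+\kappa\sum_{\nu}\sum_{x=a}^{b}|(q_x\psi)(\nu)|^2,$$ and $\mathcal{G}_\Lambda^{\mathrm{per}}=\ker H_\Lambda^{\mathrm{per}}$. Periodic tilings. Tiles: void $V=(0)$, monomer $M=(10)$, dimer $D=(0200)$; a tile covers as many consecutive ring sites as its length (tiles may lie across $b,a$). A periodic VMD-tiling of the ring $\Lambda$ is a covering of the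 ring by non-overlapping such tiles; $\mathcal{T}_\Lambda^{\mathrm{per}}$ is the set of these and $\sigma_\Lambda(T)\in\mathbb{N}_0^\Lambda$ is the configuration read off from $T$. Two periodic tilings are connected, $T\leftrightarrow T'$, if one is obtained from the other by finitely many replacements of neighbouring tiles $(10)(10)\leftrightarrow(0200)$ on the ring. A periodic root tiling uses only monomers and voids; $\mathcal{R}_\Lambda^{\mathrm{per}}$ is the set of these, and $\mathcal{T}_\Lambda^{\mathrm{per}}(R)=\{T\in\mathcal{T}_\Lambda^{\mathrm{per}}:T\leftrightarrow R\}$. *)

(* Defs.v *)
From HB Require Import structures.
From mathcomp Require Import all_boot all_order all_algebra.

Set Implicit Arguments.
Unset Strict Implicit.
Unset Printing Implicit Defensive.

Import Order.TTheory GRing.Theory Num.Theory.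
Local Open Scope ring_scope.

(* The ring Lambda = [a, b] of size L = b - a + 1 >= 4 has its site labels      *)
(* taken modulo L: its sites are the elements of 'Z_L, a label x in [a, b]      *)
(* standing for its residue class.  ('Z_L has L elements as soon as 1 < L.)     *)

Definition config (L : nat) := {ffun 'Z_L -> nat}.

Definition delta (L : nat) (x : 'Z_L) : config L := [ffun y => nat_of_bool (y == x)].

Inductive tile := Void | Monomer | Dimer.

Definition tile_code (t : tile) : option bool :=
  match t with Void => None | Monomer => Some false | Dimer => Some true end.
Definition tile_decode (c : option bool) : tile :=
  match c with None => Void | Some false => Monomer | Some true => Dimer end.
Lemma tile_codeK : cancel tile_code tile_decode. Proof. by case. Qed.
HB.instance Definition _ := Countable.copy tile (can_type tile_codeK).
HB.instance Definition _ : isFinite tile := CanIsFinite tile_codeK.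

Definition tile_word (t : tile) : seq nat :=
  match t with
  | Void => [:: 0%N]
  | Monomer => [:: 1%N; 0%N]
  | Dimer => [:: 0%N; 2%N; 0%N; 0%N]
  end.

Section Tilings.
Variable L : nat.

(* The pair (x, t) is the tile t whose leftmost cell lies on the site x. *)
Definition placement := ('Z_L * tile)%type.

Definition sites (p : placement) : {set 'Z_L} :=
  [set p.1 + (j : nat)%:R | j : 'I_(size (tile_word p.2))].

Definition is_tiling (T : {set placement}) : bool :=
  [forall p in T, forall p' in T, (p != p') ==> [disjoint sites p & sites p']]
  && (\bigcup_(p in T) sites p == [set: 'Z_L]).

Definition tilings : {set {set placement}} := [set T | is_tiling T].

(* The configuration sigma_Lambda(T) read off from T. *)
Definition tiling_config (T : {set placement}) : config L :=
  [ffun y : 'Z_L =>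
     (\sum_(p in T)
        \sum_(j < size (tile_word p.2) | (p.1 + (j : nat)%:R == y)%R)
           nth 0 (tile_word p.2) j)%N].

(* T' arises from T by one replacement (10)(10) -> (0200). *)
Definition fuse (T T' : {set placement}) : bool :=
  [&& T \in tilings, T' \in tilings &
   [exists x : 'Z_L,
     [&& (x, Monomer) \in T, (x + 2%:R, Monomer) \in T &
         T' == (x, Dimer) |: (T :\: [set (x, Monomer); (x + 2%:R, Monomer)])]]].

Definition connected (T T' : {set placement}) : bool :=
  connect (fun T1 T2 => fuse T1 T2 || fuse T2 T1) T T'.

Definition root_tilings : {set {set placement}} :=
  [set T in tilings | [forall p in T, p.2 != Dimer]].

Definition tilings_of (T0 : {set placement}) : {set {set placement}} :=
  [set T in tilings | connected T T0].

Definition num_dimers (T : {set placement}) : nat :=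
  #|[set p in T | p.2 == Dimer]|.

Definition num_particles (T : {set placement}) : nat :=
  (\sum_(x : 'Z_L) tiling_config T x)%N.

End Tilings.

From mathcomp Require Import complex.
Import Normc.
From mathcomp Require Import all_classical all_reals all_analysis.
Import numFieldNormedType.Exports.
Local Open Scope classical_set_scope.
Local Open Scope ring_scope.

(* Bases of a linear subspace G of a (possibly infinite-dimensional) space;     *)
(* the equivalence in [is_basis] says that G is the linear span of v.           *)
Definition is_basis (F : fieldType) (V : lmodType F) (G : set V)
    (I : finType) (v : I -> V) : Prop :=
  (forall c : I -> F, \sum_i c i *: v i = 0 -> forall i, c i = 0) /\
  (forall u : V, G u <-> exists c : I -> F, u = \sum_i c i *: v i).

Definition has_dim (F : fieldType) (V : lmodType F) (G : set V) (n : nat) : Prop :=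
  exists v : 'I_n -> V, is_basis G v.

(* Unconditional sums, meaningful for absolutely summable families. *)
Definition rsum (R : realType) (X : choiceType) (f : X -> R) : R :=
  fine (\esum_(i in [set: X]) (Num.max (f i) 0)%:E)
  - fine (\esum_(i in [set: X]) (Num.max (- f i) 0)%:E).

Definition csum (R : realType) (X : choiceType) (f : X -> R[i]) : R[i] :=
  Complex (rsum (fun i => complex.Re (f i))) (rsum (fun i => complex.Im (f i))).

(* The Hilbert space l^2(X) is the set [l2] of square-summable functions in the *)
(* vector space [wavefun] of all functions on X.                                *)
Section SquareSummable.
Variables (R : realType) (X : choiceType).

Definition wavefun := X -> R[i]^o.

Definition normsq (psi : wavefun) : \bar R :=
  \esum_(m in [set: X]) (normc (psi m) ^+ 2)%:E.

Definition l2 : set wavefun := [set psi | (normsq psi < +oo)%E].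

Definition inner (phi psi : wavefun) : R[i] :=
  csum (fun m => (phi m)^*%C * psi m).

Definition ket (m : X) : wavefun := fun m' => (m' == m)%:R.

(* Finite linear combinations of the basis vectors. *)
Definition finsupp : set wavefun :=
  [set psi | finite_set [set m | psi m != 0]].

(* [friedrichs h psi eta]: psi is in the domain of the Friedrichs operator A of *)
(* the sesquilinear form h on [finsupp], and A psi = eta.  The form domain is   *)
(* the completion of [finsupp] for h(phi, phi) + |phi|^2, h extends to it as    *)
(* h(chi, psi) = lim_n h(chi, phi_n), and A psi = eta iff h(chi, psi) =         *)
(* <chi, eta> for all chi in the form core [finsupp].                           *)
Definition friedrichs (h : wavefun -> wavefun -> R[i]) (psi eta : wavefun) : Prop :=
  [/\ l2 psi, l2 eta &
   exists phi : nat -> wavefun,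
     [/\ forall n, finsupp (phi n),
         normsq (phi n - psi) @[n --> \oo] --> 0%E,
         forall e : R, 0 < e -> exists n0 : nat, forall m n : nat,
           (n0 <= m)%N -> (n0 <= n)%N ->
           normc (h (phi m - phi n) (phi m - phi n)) < e &
         forall chi, finsupp chi ->
           normc (h chi (phi n) - inner chi eta) @[n --> \oo] --> (0 : R)]].

End SquareSummable.

Section Hamiltonian.
Variables (R : realType) (L : nat) (kappa : R) (lambda : R[i]).

Definition state := wavefun R (config L).

Definition csqrt_nat (n : nat) : R[i] := (Num.sqrt (n%:R : R))%:C%C.

Definition qop (x : 'Z_L) (psi : state) : state := fun nu =>
  csqrt_nat ((nu x).+1 * (nu x).+2)%N * psi (nu + delta x *+ 2)
  - lambda * csqrt_nat ((nu (x - 1)%R).+1 * (nu (x + 1)%R).+1)%N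
    * psi (nu + delta (x - 1) + delta (x + 1)).

Definition electrostatic (m : config L) : nat :=
  (\sum_(x : 'Z_L) m x * m (x + 1)%R)%N.

(* The sesquilinear form whose quadratic form is                                *)
(* sum_m electrostatic(m) |psi(m)|^2 + kappa sum_nu sum_x |(q_x psi)(nu)|^2.    *)
Definition energy_form (phi psi : state) : R[i] :=
  csum (fun m => (electrostatic m)%:R * ((phi m)^*%C * psi m))
  + kappa%:C%C
    * csum (fun nu => \sum_(x : 'Z_L) (qop x phi nu)^*%C * qop x psi nu).

Definition hamiltonian (psi eta : state) : Prop :=
  friedrichs energy_form psi eta.

Definition ground_space : set state := [set psi | hamiltonian psi 0].

Definition number_at (x : 'Z_L) (psi : state) : state :=
  fun m => (m x)%:R * psi m.

Definition number_op (psi : state) : state :=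
  \sum_(x : 'Z_L) number_at x psi.

Definition vmd_state (T0 : {set placement L}) : state :=
  \sum_(T in tilings_of T0)
    (lambda / csqrt_nat 2) ^+ num_dimers T *: ket R (tiling_config T).

End Hamiltonian.

Arguments ground_space {R} L kappa lambda _.
Arguments hamiltonian {R} L kappa lambda psi eta.
Arguments energy_form {R} L kappa lambda phi psi.

Definition golden (R : realType) : R := (1 + Num.sqrt 5) / 2.

(* Main.v *)
(* A vector annihilated by the electrostatic term and by all q_x is supported on
   the configurations read off from VMD-tilings: q_x moves a pair at x to x - 1
   and x + 1, so a triple at x, or a particle too close to a pair, would force a
   nonzero amplitude at a configuration with two occupied neighbours.  On tilings
   q_x = 0 says precisely that fusing (10)(10) into (0200) multiplies the amplitude
   by lambda / sqrt 2.  Splitting all dimers sends every tiling to the unique root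
   tiling connected to it, so the amplitudes at root tilings are free parameters.

   For the Friedrichs operator, A psi = 0 gives a form-Cauchy sequence phi_n -> psi
   with h(phi_m, phi_n) -> 0 as n -> oo for every m; hence h(phi_n, phi_n) -> 0,
   and since each summand of the form is nonnegative and depends on finitely many
   amplitudes, it vanishes at psi.

   Root tilings of a ring of L sites restrict to binary words of length L without
   two consecutive ones, and every such word of length L - 1 closes up to a ring;
   these words are counted by Fibonacci numbers. *)

Require Import Defs.
From mathcomp Require Import all_boot all_order all_algebra complex.
From mathcomp Require Import all_classical all_reals all_analysis.
From mathcomp Require Import zify ring lra.

Set Implicit Arguments.
Unset Strict Implicit.
Unset Printing Implicit Defensive.

Import Order.TTheory GRing.Theory Num.Theory.
Local Open Scope ring_scope.

(** * Tilings of the ring *)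

Section Tilings.
Variable L : nat.
Implicit Types (x y : 'Z_L) (T : {set placement L}) (m : config L).

Lemma sum_tile (F : tile -> nat) :
  (\sum_t F t = F Void + F Monomer + F Dimer)%N.
Proof.
rewrite (bigD1 Void) //= (bigD1 Monomer) //= (bigD1 Dimer) //= big1 ?addn0 ?addnA //.
by case.
Qed.

Definition occ T (t : tile) (x : 'Z_L) : bool := (x, t) \in T.

(** A tile whose cell [j] lies on [y] starts at [y - j]. With the cell contents as weight [w] this
    yields the configuration; with weight 1 it counts the tiles over [y]. *)
Lemma sum_placements T (w : tile -> nat -> nat) y :
  (\sum_(p in T) \sum_(j < size (tile_word p.2) | (p.1 + (j : nat)%:R == y)%R)
     w p.2 j =
   \sum_t \sum_(j < size (tile_word t)) w t j * occ T t (y - (j : nat)%:R)%R)%N.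
Proof.
rewrite big_mkcond /=.
transitivity (\sum_(x : 'Z_L) \sum_(t : tile)
  \sum_(j < size (tile_word t))
    (x + (j : nat)%:R == y)%R * (w t j * occ T t x))%N.
  rewrite pair_big /=; apply: eq_bigr => -[x t] _ /=; rewrite /occ.
  case: ifP => xT; last by rewrite big1 // => j _; rewrite !muln0.
  by rewrite big_mkcond /=; apply: eq_bigr => j _; case: eqP; rewrite ?muln1 ?mul1n ?mul0n.
rewrite exchange_big /=; apply: eq_bigr => t _; rewrite exchange_big /=.
apply: eq_bigr => j _; rewrite (bigD1 (y - (j : nat)%:R)) //= big1 ?addn0.
  by rewrite subrK eqxx mul1n.
by move=> x; rewrite -subr_eq0 opprB addrA subr_eq0 => /negPf->.
Qed.

Lemma tiling_configE T y :
  tiling_config T y = (occ T Monomer y + (occ T Dimer (y - 1)%R).*2)%N.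
Proof.
rewrite ffunE (sum_placements T (fun t j => nth 0 (tile_word t) j)) sum_tile.
rewrite !big_ord_recl !big_ord0 /= subr0.
by rewrite !mul0n !mul1n !addn0 !add0n mul2n.
Qed.

(* The number of tiles of [T] covering [y], provided [3 < L], so that the four
   cells of a dimer are distinct sites. *)
Definition coverage T y : nat :=
  (occ T Void y + (occ T Monomer y + occ T Monomer (y - 1)%R) +
   (occ T Dimer y + occ T Dimer (y - 1)%R + occ T Dimer (y - 2%:R)%R +
    occ T Dimer (y - 3%:R)%R))%N.

(* The local conditions on [m] at [x] that together characterise the
   configurations read off from tilings. *)
Definition vmd_at m x : bool :=
  [&& m x <= 2, (m x == 0) || (m (x + 1)%R == 0)
    & (m x != 2) || [&& m (x + 2%:R)%R == 0, m (x - 2%:R)%R == 0 & m (x + 3%:R)%R != 2]]%N.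

Definition vmd_config m := [forall x, vmd_at m x].

Lemma vmd_configP m : reflect (forall x, vmd_at m x) (vmd_config m).
Proof. exact: forallP. Qed.

(** The inverse of [tiling_config]. The pair of a dimer sits on its second cell, and a void is an
    empty site that is neither the second cell of a monomer nor the first, third or fourth cell of a
    dimer. *)
Definition tiling_of m : {set placement L} :=
  [set p | match p.2 with
           | Void => [&& m p.1 == 0, m (p.1 - 1)%R == 0, m (p.1 + 1)%R != 2
                       & m (p.1 - 2%:R)%R != 2]%N
           | Monomer => m p.1 == 1
           | Dimer => m (p.1 + 1) == 2
           end].

Lemma tiling_ofK m : vmd_config m -> tiling_config (tiling_of m) = m.
Proof.
move=> /vmd_configP mV; apply/ffunP => y; rewrite tiling_configE /occ !inE /= subrK.
by have /andP[+ _] := mV y; case: (m y) => [|[|[|?]]].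
Qed.

(* [x + k] and [x - k] elaborate to different canonical instances of the
   addition, hence the ssreflect [move:], which abstracts up to conversion. *)
Ltac generalize_occ :=
  repeat match goal with |- context [nat_of_bool (occ ?T ?t ?x)] =>
    move: (nat_of_bool (occ T t x)) => ? end.

Lemma nat_of_bool_inj : injective nat_of_bool.
Proof. by case=> -[]. Qed.

(* [T'] arises from [T] by fusing the monomers at [x] and [x + 2]; stated
   additively, so that [coverage] and [tiling_config] follow by linear arithmetic. *)
Definition fuses x T T' := forall y,
  [/\ occ T' Void y = occ T Void y,
      occ T' Monomer y + ((y == x) + (y == (x + 2%:R)%R)) = occ T Monomer y
    & occ T' Dimer y = occ T Dimer y + (y == x) :> nat]%N.

Definition fuse_at x T : {set placement L} :=
  (x, Dimer) |: (T :\: [set (x, Monomer); (x + 2%:R, Monomer)]).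

Definition split_at x T : {set placement L} :=
  (x, Monomer) |: ((x + 2%:R, Monomer) |: (T :\ (x, Dimer))).

(** The dimer at [x] covers the same four sites as the monomers at [x] and [x + 2]. *)
Lemma fuses_coverage x T T' : fuses x T T' -> coverage T' =1 coverage T.
Proof.
move=> fT y; rewrite /coverage.
have [-> <- ->] := fT y; have [_ <- ->] := fT (y - 1).
have [_ _ ->] := fT (y - 2%:R); have [_ _ ->] := fT (y - 3%:R).
have -> : (y - 1 == x + 2%:R) = (y - 3%:R == x).
  by rewrite -subr_eq; congr (_ == _); ring.
rewrite [y == x + 2%:R](_ : _ = (y - 2%:R == x)) ?subr_eq //.
lia.
Qed.

Lemma fuses_config x T T' y : fuses x T T' ->
  (tiling_config T' y + ((y == x) + (y == (x + 2%:R)%R)) =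
   tiling_config T y + (y == (x + 1)%R).*2)%N.
Proof.
move=> fT; rewrite !tiling_configE; have [_ <- _] := fT y; have [_ _ ->] := fT (y - 1).
rewrite subr_eq; generalize_occ; move: (y == x) (y == x + 2%:R) (y == x + 1) => *; lia.
Qed.

Lemma num_dimersE T : num_dimers T = (\sum_x occ T Dimer x)%N.
Proof.
transitivity (\sum_(x : 'Z_L) \sum_t (occ T t x && (t == Dimer)))%N.
  rewrite pair_big /num_dimers -sum1_card big_mkcond /=.
  by apply: eq_bigr => -[x t] _; rewrite inE /=; case: (_ && _).
apply: eq_bigr => x _; rewrite (bigD1 Dimer) //= big1 ?addn0 ?andbT //.
by move=> t /negPf->; rewrite andbF.
Qed.

Lemma fuses_num_dimers x T T' : fuses x T T' -> num_dimers T' = (num_dimers T).+1.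
Proof.
move=> fT; rewrite !num_dimersE (eq_bigr (fun y => occ T Dimer y + (y == x))%N).
  rewrite big_split /= -[RHS]addn1; congr addn.
  by rewrite (bigD1 x) //= eqxx big1 ?addn0 // => y /negPf->.
by move=> y _; have [_ _ ->] := fT y.
Qed.

(** All dimers split at once: a dimer at [x] becomes monomers at [x] and [x + 2]. In this closed
    form, invariance under a fusion is checked site by site. *)
Definition root_of T : {set placement L} :=
  [set p | match p.2 with
           | Void => occ T Void p.1
           | Monomer => [|| occ T Monomer p.1, occ T Dimer p.1 | occ T Dimer (p.1 - 2%:R)]
           | Dimer => false
           end].

Lemma fuses_root_of x T T' : fuses x T T' -> root_of T' = root_of T.
Proof.
move=> fT; apply/setP => -[y t]; rewrite !inE; case: t => //=.
  by have [-> _ _] := fT y.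
have [_ + +] := fT y; have [_ _] := fT (y - 2%:R); rewrite subr_eq.
by move: (y == x) (y == x + 2%:R) => [] []; do 6!case: (occ _ _ _).
Qed.

Lemma root_tilingP T :
  reflect (T \in tilings L /\ forall x, occ T Dimer x = false) (T \in root_tilings L).
Proof.
rewrite [T \in root_tilings L]inE; apply: (iffP andP) => -[tT dT]; split => //.
  by move=> x; apply/negP => xT; have /forall_inP/(_ _ xT) := dT.
by apply/forall_inP => -[x []] //; have := dT x; rewrite /occ => ->.
Qed.

Lemma root_of_id T : T \in root_tilings L -> root_of T = T.
Proof.
case/root_tilingP => tT dT; apply/setP => -[y t]; rewrite inE /= !dT !orbF.
by case: t => //; have := dT y.
Qed.

Hypothesis L4 : (3 < L)%N.

Lemma val_natZ k : (k < L)%N -> val (k%:R : 'Z_L) = k.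
Proof. by move=> kL; rewrite /= val_Zp_nat ?modn_small //; case: L L4 => [|[]]. Qed.

Lemma natZ_inj j k : (j < L)%N -> (k < L)%N -> j%:R = k%:R :> 'Z_L -> j = k.
Proof. by move=> jL kL /(congr1 val); rewrite !val_natZ. Qed.

Lemma size_tile_word t : (size (tile_word t) <= L)%N.
Proof. by case: t => //=; lia. Qed.

Lemma coverageE T y : (\sum_(p in T) (y \in sites p) = coverage T y)%N.
Proof.
transitivity (\sum_(p in T) \sum_(j < size (tile_word p.2) |
    (p.1 + (j : nat)%:R == y)%R) 1)%N.
  apply: eq_bigr => -[x t] _ /=.
  have [/imsetP[/= j _ yj]|/imsetP Ny] := boolP (y \in sites (x, t)).
    (* No tile is longer than the ring, so at most one of its cells lies on [y]. *)
    rewrite (bigD1 j) /=; last by rewrite yj.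
    rewrite big1 // => k /andP[/eqP]; rewrite yj => /addrI e /eqP []; apply: val_inj.
    by apply: natZ_inj e; apply: leq_trans (ltn_ord _) _; exact: size_tile_word.
  rewrite big1 // => j /eqP yj; case: Ny; exists j => //.
rewrite (sum_placements T (fun _ _ => 1%N)) sum_tile.
rewrite !big_ord_recl !big_ord0 /= subr0 !mul1n !addn0.
by rewrite /coverage !addnA.
Qed.

(** Turns the tiling condition into one linear equation per site, which opens it to linear
    arithmetic on occupation numbers. *)
Lemma tilingP T : reflect (forall y, coverage T y = 1%N) (T \in tilings L).
Proof.
rewrite inE; apply: (iffP andP) => [[/forall_inP dT /eqP cT] y|cT].
  have : y \in \bigcup_(p in T) sites p by rewrite cT inE.
  case/bigcupP=> p pT yp; rewrite -coverageE (bigD1 p) //= yp big1 //.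
  move=> q /andP[qT qp]; apply/eqP; rewrite eqb0; apply/negP => yq.
  have /forall_inP/(_ _ qT)/implyP := dT _ pT; rewrite eq_sym => /(_ qp).
  by move/pred0P => /(_ y) /=; rewrite yp yq.
split; last first.
  rewrite finset.eqEsubset; apply/andP; split; apply/fintype.subsetP => y; rewrite // inE => _.
  have : (0 < \sum_(p in T) (y \in sites p))%N by rewrite coverageE cT.
  rewrite lt0n sum_nat_eq0 negb_forall_in => /exists_inP[p pT].
  by rewrite eqb0 negbK => yp; apply/bigcupP; exists p.
apply/forall_inP => p pT; apply/forall_inP => q qT; apply/implyP => pq.
apply/pred0P => y /=; apply/negP => /andP[yp yq].
have := coverageE T y; rewrite cT (bigD1 p) //= (bigD1 q) /=; last by rewrite qT eq_sym.
by rewrite yp yq.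
Qed.

Lemma vmd_tiling_config T : T \in tilings L -> vmd_config (tiling_config T).
Proof.
move=> /tilingP cT; apply/vmd_configP => x; rewrite /vmd_at !tiling_configE.
have := cT x; have := cT (x + 1); have := cT (x - 1); have := cT (x + 2%:R).
(* [generalize_occ] forgets that occupation numbers are at most 1. The four coverage equations
   restore this for all those in the goal except this one. *)
have := leq_b1 (occ T Monomer (x + 3%:R)).
rewrite /coverage.
have -> : x + 1 - 1 = x by ring.
have -> : x + 1 - 2%:R = x - 1 by ring.
have -> : x + 1 - 3%:R = x - 2%:R by ring.
have -> : x - 1 - 1 = x - 2%:R by ring.
have -> : x - 1 - 2%:R = x - 3%:R by ring.
have -> : x - 2%:R - 1 = x - 3%:R by ring.
have -> : x + 3%:R - 1 = x + 2%:R by ring.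
have -> : x + 2%:R - 1 = x + 1 by ring.
have -> : x + 2%:R - 2%:R = x by ring.
have -> : x + 2%:R - 3%:R = x - 1 by ring.
by generalize_occ; move=> *; apply/and3P; split; lia.
Qed.

(** The coverage of [y] depends only on [m] at [y - 2], ..., [y + 1]; these values are at most 2,
    which leaves finitely many patterns. *)
Lemma tiling_ofP m : vmd_config m -> tiling_of m \in tilings L.
Proof.
move=> /vmd_configP mV; apply/tilingP => y; rewrite /coverage /occ !inE /=.
have -> : y - 1 + 1 = y by ring.
have -> : y - 2%:R + 1 = y - 1 by ring.
have -> : y - 3%:R + 1 = y - 2%:R by ring.
have := mV y; have := mV (y + 1); have := mV (y - 1); have := mV (y - 2%:R).
rewrite /vmd_at.
have -> : y - 1 + 1 = y by ring.
have -> : y - 2%:R + 1 = y - 1 by ring.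
have -> : y - 2%:R + 2%:R = y by ring.
have -> : y - 2%:R + 3%:R = y + 1 by ring.
have -> : y - 1 + 2%:R = y + 1 by ring.
have -> : y + 1 - 2%:R = y - 1 by ring.
case: (m y) => [|[|[|?]]] //; case: (m (y - 1)) => [|[|[|?]]] //;
case: (m (y - 2%:R)) => [|[|[|?]]] //; case: (m (y + 1)) => [|[|[|?]]] //=;
by rewrite ?andbF ?orbF.
Qed.

Lemma tiling_configK T : T \in tilings L -> tiling_of (tiling_config T) = T.
Proof.
move=> /tilingP cT; apply/setP => -[y t]; rewrite inE /= !tiling_configE -/(occ T t y).
have -> : y + 1 - 1 = y by ring.
have -> : y - 1 - 1 = y - 2%:R by ring.
have -> : y - 2%:R - 1 = y - 3%:R by ring.
have := cT y; have := cT (y + 1); have := cT (y - 2%:R); rewrite /coverage.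
have := leq_b1 (occ T Monomer (y + 1)); have := leq_b1 (occ T Monomer (y - 2%:R)).
have -> : y + 1 - 1 = y by ring.
have -> : y + 1 - 2%:R = y - 1 by ring.
have -> : y + 1 - 3%:R = y - 2%:R by ring.
have -> : y - 2%:R - 1 = y - 3%:R by ring.
by case: t; [case: (occ T Void y) | case: (occ T Monomer y) | case: (occ T Dimer y)];
  rewrite /=; generalize_occ; move=> *; lia.
Qed.

Lemma tiling_config_inj : {in tilings L &, injective (@tiling_config L)}.
Proof. by move=> T T' /tiling_configK {2}<- /tiling_configK {2}<- ->. Qed.

Lemma addZ_neq x k : (0 < k < L)%N -> (x + k%:R == x) = false.
Proof.
case/andP=> k0 kL; apply/negP; rewrite -{2}[x]addr0 => /eqP/addrI/(@natZ_inj k 0) k0E.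
by rewrite k0E // in k0; lia.
Qed.

Lemma addZ2_neq x : (x == x + 2%:R) = false.
Proof. by rewrite eq_sym addZ_neq //=; lia. Qed.

Lemma fuses_fuse_at x T : T \in tilings L ->
  occ T Monomer x -> occ T Monomer (x + 2%:R) -> fuses x T (fuse_at x T).
Proof.
move=> /tilingP cT Mx Mx2 y; rewrite /occ !inE !xpair_eqE /= ?andbF ?andbT /=.
rewrite -/(occ T Void y) -/(occ T Monomer y) -/(occ T Dimer y); split => //.
  have Nx := addZ2_neq x; case: (y =P x) => [->|_] /=; first by rewrite Nx Mx.
  by case: (y =P _) => [->|_] /=; rewrite ?Mx2 ?addn0.
case: eqP => [->|_] /=; rewrite ?addn0 //.
by have := cT x; rewrite /coverage Mx; case: (occ T Dimer x) => //; lia.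
Qed.

Lemma fuses_split_at x T : T \in tilings L -> occ T Dimer x -> fuses x (split_at x T) T.
Proof.
move=> /tilingP cT Dx y; rewrite /occ !inE !xpair_eqE /= ?andbF ?andbT /=.
rewrite -/(occ T Void y) -/(occ T Monomer y) -/(occ T Dimer y); split => //.
  have := cT x; have := cT (x + 2%:R); rewrite /coverage addrK Dx.
  have Nx := addZ2_neq x; case: (y =P x) => [->|_] /=; first by rewrite Nx; generalize_occ; lia.
  by case: (y =P _) => [->|_] /=; rewrite ?addn0 //; generalize_occ; lia.
by case: eqP => [->|_] /=; rewrite ?addn0 //= Dx.
Qed.

(** Links the set-theoretic replacement to its additive form; the additive equations determine [T']
    from [T] and [x]. *)
Lemma fusesP T T' : T \in tilings L -> T' \in tilings L ->
  reflect (exists x, fuses x T T') (fuse T T').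
Proof.
move=> tT tT'; rewrite /fuse tT tT' /=; apply: (iffP existsP) => -[x].
  by case/and3P=> Mx Mx2 /eqP->; exists x; apply: fuses_fuse_at.
move=> fT; exists x; have [_ + _] := fT x; have [_ + _] := fT (x + 2%:R).
rewrite !eqxx -/(occ T Monomer x) -/(occ T Monomer (x + 2%:R)) => Mx2 Mx.
have {}Mx : occ T Monomer x by case: (occ T _ x) Mx => //; lia.
have {}Mx2 : occ T Monomer (x + 2%:R) by case: (occ T _ _) Mx2 => //; lia.
rewrite Mx Mx2 /=; apply/eqP/setP => -[y t].
rewrite -/(occ T' t y) -/(occ (fuse_at x T) t y).
have [V1 M1 D1] := fT y; have [V2 M2 D2] := fuses_fuse_at tT Mx Mx2 y.
case: t; first by rewrite V1.
  by apply/nat_of_bool_inj/(@addIn ((y == x) + (y == x + 2%:R)%R)%N); rewrite M1 M2.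
by apply: nat_of_bool_inj; rewrite D1 D2.
Qed.

Lemma fuses_tiling x T T' : fuses x T T' -> (T' \in tilings L) = (T \in tilings L).
Proof. by move/fuses_coverage=> e; apply/tilingP/tilingP => cT y; rewrite -(cT y) e. Qed.

(** All three placements cover [y], so at most one occurs and the disjunction in [root_of] becomes a
    sum. *)
Lemma occ_root_of_Monomer T y : T \in tilings L -> occ (root_of T) Monomer y =
  (occ T Monomer y + occ T Dimer y + occ T Dimer (y - 2%:R)%R)%N :> nat.
Proof.
move=> /tilingP cT; rewrite {1}/occ inE /=; have := cT y; rewrite /coverage.
by case: (occ T Monomer y); case: (occ T Dimer y); case: (occ T Dimer (y - 2%:R)); lia.
Qed.

Lemma root_of_root T : T \in tilings L -> root_of T \in root_tilings L.
Proof.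
move=> tT; apply/root_tilingP; split; last by move=> x; rewrite /occ inE.
apply/tilingP => y; move/tilingP: (tT) => /(_ y) <-; rewrite /coverage !occ_root_of_Monomer //.
rewrite [occ (root_of T) Void y]inE /= (_ : y - 1 - 2%:R = y - 3%:R); last by ring.
by rewrite ![occ (root_of T) Dimer _]inE /=; generalize_occ; lia.
Qed.

(** Induction on the number of dimers: splitting one lowers it by one and keeps the root. *)
Lemma connected_root_of T : T \in tilings L -> Defs.connected T (root_of T).
Proof.
have [n] := ubnP (num_dimers T); elim: n => // n IHn in T *; rewrite ltnS => dT tT.
have [rT|] := boolP (T \in root_tilings L); first by rewrite root_of_id // /Defs.connected connect0.
rewrite inE tT negb_forall_in => /exists_inP[[x t] /= xT]; rewrite negbK => /eqP et.
have fT : fuses x (split_at x T) T by apply: fuses_split_at; rewrite // /occ -et.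
have tT' : split_at x T \in tilings L by rewrite -(fuses_tiling fT).
rewrite (fuses_root_of fT); apply: connect_trans (IHn _ _ tT').
  by apply: connect1; apply/orP; right; apply/fusesP => //; exists x.
by rewrite -(fuses_num_dimers fT).
Qed.

Lemma connected_eq_root_of T T' : Defs.connected T T' -> root_of T = root_of T'.
Proof.
case/connectP=> p + ->; elim: p T => //= T1 p IHp T /andP[TT1 /IHp <-].
have fE T2 T3 : fuse T2 T3 -> root_of T3 = root_of T2.
  move=> f23; have /and3P[t2 t3 _] := f23.
  by have /(fusesP t2 t3)[x /fuses_root_of] := f23.
by case/orP: TT1 => /fE.
Qed.

(** Connected classes are the fibres of [root_of], which replaces reachability by an equation. *)
Lemma mem_tilings_of T0 T : T0 \in root_tilings L ->
  (T \in tilings_of T0) = (T \in tilings L) && (root_of T == T0).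
Proof.
move=> rT0; rewrite [LHS]inE; case tT: (T \in _) => //=.
apply/idP/eqP => [/connected_eq_root_of->|<-].
  exact: root_of_id.
exact: connected_root_of.
Qed.

End Tilings.

(** * Counting root tilings *)

Section SparseWords.

Definition sparse (s : seq bool) := sorted (fun b c => ~~ (b && c)) s.

(** A nonempty sparse word starts with 0, starts with 10, or is the single letter 1; the first two
    cases give the Fibonacci recursion. *)
Fixpoint sparse_words n : seq (seq bool) :=
  if n is n'.+1 then
    map (cons false) (sparse_words n') ++
    (if n' is n''.+1 then map (fun s => true :: false :: s) (sparse_words n'')
     else [:: [:: true]])
  else [:: [::]].

Lemma sparse_false s : sparse (false :: s) = sparse s.
Proof. by case: s. Qed.

Lemma mem_sparse_words n s : (s \in sparse_words n) = (size s == n) && sparse s.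
Proof.
have [k] := ubnP n; elim: k => // k IHk in n s *.
case: n => [|n] nk; first by case: s.
have consI b : injective (cons b) by move=> ? ? [].
rewrite /= mem_cat; case: s => [|[] s].
- rewrite (_ : [::] \in _ = false) /=; last by apply/mapP => -[].
  by case: n {nk} => // n; apply/mapP => -[].
- rewrite (_ : true :: s \in _ = false) /=; last by apply/mapP => -[].
  case: n nk => [|n] nk; first by case: s.
  case: s => [|[] s] /=.
  + by apply/mapP => -[].
  + by rewrite andbF; apply/mapP => -[].
  + rewrite mem_map; last by move=> ? ? [].
    by rewrite IHk -?(sparse_false s) //; lia.
- rewrite (mem_map (@consI _ _)) IHk // -(sparse_false s) [X in _ || X](_ : _ = false) ?orbF //.
  by case: n {nk} => // n; apply/mapP => -[].
Qed.

Lemma sparse_words_uniq n : uniq (sparse_words n).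
Proof.
have [k] := ubnP n; elim: k => // k IHk in n *.
case: n => [|n] nk //=; rewrite cat_uniq map_inj_uniq ?IHk //=; last by move=> ? ? [].
apply/andP; split; last first.
  by case: n nk => [|n] nk //; rewrite map_inj_uniq ?IHk //; [lia | move=> ? ? []].
apply/hasPn => s; have: s \in map (cons false) (sparse_words n) -> head true s = false.
  by case/mapP=> ? _ ->.
case: n {nk} => [|n].
  by move=> H /predU1P[sE|//]; apply/negP => /H; rewrite sE.
by move=> H /mapP[? _ sE]; apply/negP => /H; rewrite sE.
Qed.

Lemma size_sparse_words n : size (sparse_words n.+2) =
  (size (sparse_words n.+1) + size (sparse_words n))%N.
Proof. by rewrite [LHS]size_cat !size_map. Qed.

Variable R : realType.

Lemma golden_sqr : golden R ^+ 2 = golden R + 1.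
Proof.
rewrite /golden; have : (Num.sqrt 5 : R) ^+ 2 = 5 by rewrite sqr_sqrtr.
by move: (Num.sqrt 5) => r r2; lra.
Qed.

Lemma golden_gt1 : 1 < golden R.
Proof.
(* The bound by 1/2 selects the positive root of the quadratic equation. *)
have := golden_sqr; have : 0 <= golden R - 2^-1.
  by rewrite /golden; have := sqrtr_ge0 (5 : R); lra.
by nra.
Qed.

Lemma golden_lt2 : golden R < 2.
Proof. by have := golden_sqr; have := golden_gt1; nra. Qed.

(** Powers of the golden ratio obey the same recursion, so both bounds propagate from lengths 0 and
    1, where the counts are 1 and 2. *)
Lemma size_sparse_words_bounds n :
  golden R ^+ n <= (size (sparse_words n))%:R <= golden R ^+ n.+1.
Proof.
have [k] := ubnP n; elim: k => // k IHk in n *.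
have phi2 := golden_sqr; have phi_gt1 := golden_gt1; have phi_lt2 := golden_lt2.
case: n => [|[|n]] nk.
- by rewrite expr0 expr1 lexx /= ltW.
- by rewrite expr1 phi2 /=; apply/andP; split; lra.
have /andP[l1 u1] := IHk n.+1 ltac:(lia); have /andP[l2 u2] := IHk n ltac:(lia).
rewrite size_sparse_words natrD.
have E j : golden R ^+ j.+2 = golden R ^+ j.+1 + golden R ^+ j.
  by rewrite -addn2 exprD phi2 mulrDr mulr1 -exprSr.
by rewrite (E n) (E n.+1) !lerD.
Qed.

End SparseWords.

(** * Particle numbers of root tilings, and their encoding by words *)

Section Counting.
Variable L : nat.
Hypothesis L4 : (3 < L)%N.
Implicit Types (x y : 'Z_L) (T : {set placement L}) (m : config L).

Lemma ltnZ x : (x < L)%N.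
Proof. by have := ltn_ord x; rewrite [X in (_ < X)%N -> _]Zp_cast //; lia. Qed.

Lemma cardZ : #|{: 'Z_L}| = L.
Proof. by rewrite card_ord Zp_cast //; lia. Qed.

Lemma val_addZ1 x : (x.+1 < L)%N -> (x + 1)%R = x.+1 :> nat.
Proof.
move=> xL; rewrite -[x in LHS]natr_Zp -[X in _ + X](mulr1n 1) -natrD addn1.
exact: val_natZ.
Qed.

Lemma sum_subZ (F : 'Z_L -> nat) (z : 'Z_L) : (\sum_x F (x - z)%R = \sum_x F x)%N.
Proof. by rewrite [RHS](reindex_inj (addIr (- z))). Qed.

Lemma num_particlesE T :
  num_particles T = (\sum_x occ T Monomer x + (\sum_x occ T Dimer x).*2)%N.
Proof.
rewrite /num_particles (eq_bigr _ (fun x _ => tiling_configE T x)) big_split /=.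
rewrite -(sum_subZ (fun x => occ T Dimer x) 1) -!mul2n big_distrr /=.
by congr addn; apply: eq_bigr => ? _; rewrite mul2n.
Qed.

Lemma num_particles_root_of T : T \in tilings L ->
  num_particles (root_of T) = num_particles T.
Proof.
move=> tT; rewrite !num_particlesE [X in X.*2]big1 ?addn0; last first.
  by move=> x _; rewrite [occ _ _ _]inE.
rewrite (eq_bigr _ (fun x _ => occ_root_of_Monomer L4 x tT)) !big_split /=.
by rewrite (sum_subZ (fun x => occ T Dimer x) 2%:R) -addnA addnn.
Qed.

Lemma num_particles_root T : T \in root_tilings L ->
  num_particles T = (\sum_x occ T Monomer x)%N.
Proof.
by case/root_tilingP => _ dT; rewrite num_particlesE [X in X.*2]big1 ?addn0 // => x _; rewrite dT.
Qed.

(** Summing the coverage over the ring counts each monomer twice. *)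
Lemma num_particles_le T : T \in root_tilings L -> ((num_particles T).*2 <= L)%N.
Proof.
move=> rT; rewrite num_particles_root //; case/root_tilingP: rT => /(tilingP L4) cT _.
apply: leq_trans (_ : #|{: 'Z_L}| <= _)%N; last by rewrite cardZ.
rewrite -sum1_card -addnn -{2}(sum_subZ _ 1) -big_split /=.
by apply: leq_sum => x _; rewrite -[leqRHS](cT x) /coverage addnAC leq_addl.
Qed.

Lemma root_tiling_inj T T' : T \in root_tilings L -> T' \in root_tilings L ->
  occ T Monomer =1 occ T' Monomer -> T = T'.
Proof.
move=> /root_tilingP[tT dT] /root_tilingP[tT' dT'] eM; apply: (tiling_config_inj L4) => //.
by apply/ffunP => x; rewrite !tiling_configE dT dT' eM.
Qed.

Definition word_root (s : seq bool) : {set placement L} :=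
  tiling_of [ffun x : 'Z_L => nth false s x : nat].

Lemma occ_word_root s x : occ (word_root s) Monomer x = nth false s x.
Proof. by rewrite [LHS]inE /= ffunE; case: (nth _ _ _). Qed.

(** Sites past the end of [s] are empty by the default of [nth]. As [s] is shorter than the ring,
    the last site is empty and no two particles meet where the ring closes. *)
Lemma word_root_root s : (size s < L)%N -> sparse s -> word_root s \in root_tilings L.
Proof.
move=> sL ss; apply/root_tilingP; split; last first.
  by move=> x; rewrite [LHS]inE /= ffunE; case: (nth _ _ _).
apply: tiling_ofP => //; apply/vmd_configP => x; rewrite /vmd_at !ffunE.
have sx : ~~ (nth false s x && nth false s (x + 1)%R).
  have [xs|/(nth_default _)->//] := ltnP x (size s).
  rewrite val_addZ1; last exact: leq_ltn_trans sL.
  have [xs1|/(nth_default _)->] := ltnP x.+1 (size s); last by rewrite andbF.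
  by have /(sortedP false) := ss; apply.
by case: (nth false s x) (nth false s (x + 1)%R) sx => -[].
Qed.

Lemma sparse_root_word T : T \in root_tilings L ->
  mkseq (fun i => occ T Monomer i%:R) L \in sparse_words L.
Proof.
case/root_tilingP => /(tilingP L4) cT _.
rewrite mem_sparse_words size_mkseq eqxx; apply/(sortedP false) => i; rewrite size_mkseq => iL.
rewrite !nth_mkseq //; last exact: ltnW.
have := cT i.+1%:R; rewrite /coverage -[i.+1]addn1 natrD addrK.
by case: (occ T Monomer i%:R); case: (occ T Monomer (i%:R + 1%:R)) => //; lia.
Qed.

Lemma card_root_tilings_le : (#|root_tilings L| <= size (sparse_words L))%N.
Proof.
rewrite cardE -(size_map (fun T => mkseq (fun i => occ T Monomer i%:R) L)).
apply: uniq_leq_size; last by move=> _ /mapP[T + ->]; rewrite mem_enum; exact: sparse_root_word.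
rewrite map_inj_in_uniq ?enum_uniq // => T T'; rewrite !mem_enum => rT rT' eTT'.
apply: root_tiling_inj => // x; have := congr1 (fun s => nth false s x) eTT'.
by rewrite !nth_mkseq ?ltnZ // natr_Zp.
Qed.

Lemma card_root_tilings_ge : (size (sparse_words L.-1) <= #|root_tilings L|)%N.
Proof.
have sP s : s \in sparse_words L.-1 -> size s = L.-1 /\ sparse s.
  by rewrite mem_sparse_words => /andP[/eqP].
rewrite cardE -(size_map word_root); apply: uniq_leq_size; last first.
  by move=> _ /mapP[s /sP[sL ss] ->]; rewrite mem_enum word_root_root // sL; lia.
rewrite map_inj_in_uniq ?sparse_words_uniq // => s s' /sP[sL _] /sP[sL' _] e.
apply: (@eq_from_nth _ false) => [|i]; rewrite ?sL ?sL' // => iL.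
have := congr1 (fun T => occ T Monomer i%:R) e.
by rewrite !occ_word_root !val_natZ //; lia.
Qed.

Lemma packed_root_tiling :
  exists2 T, T \in root_tilings L & num_particles T = (L./2)%N.
Proof.
(* Particles on the even sites below [L - 1]; the last site stays empty, so that for odd [L] the two
   ends do not clash. *)
set s := mkseq (fun i => ~~ odd i) L.-1.
have rs : word_root s \in root_tilings L.
  apply: word_root_root; first by rewrite size_mkseq; lia.
  apply/(sortedP false) => i; rewrite size_mkseq => iL.
  by rewrite !nth_mkseq //= ?negbK; [case: odd | lia].
exists (word_root s) => //; rewrite num_particles_root //.
rewrite (eq_bigr (fun x : 'Z_L => nat_of_bool (nth false s x))); last first.
  by move=> x _; rewrite occ_word_root.
rewrite -(big_mkord xpredT (fun i => nat_of_bool (nth false s i))) Zp_cast; last by lia.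
rewrite -{1}(prednK (ltn_trans _ L4)) // big_nat_recr //= nth_default ?size_mkseq // addn0.
rewrite (eq_big_nat _ _ (F2 := fun i => nat_of_bool (~~ odd i))); last first.
  by move=> i /andP[_ iL]; rewrite nth_mkseq.
have E n : (\sum_(0 <= i < n) ~~ odd i = uphalf n)%N.
  elim: n => [|n IHn]; first by rewrite big_nil.
  by rewrite big_nat_recr //= IHn; have := odd_double_half n; lia.
by rewrite E; lia.
Qed.

End Counting.

(** * The Friedrichs operator *)

Section UnconditionalSums.
Import Normc.
Import numFieldNormedType.Exports.
Local Open Scope classical_set_scope.
Variables (R : realType) (X : choiceType).

Lemma esum_seq (s : seq X) (a : X -> R) : uniq s -> (forall i, 0 <= a i) ->
  (forall i, i \notin s -> a i = 0) ->
  \esum_(i in [set: X]) (a i)%:E = (\sum_(i <- s) a i)%:E.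
Proof.
move=> us a0 as0.
rewrite -sumEFin fsbig_seq // -esum_fset //; last first.
  by move=> i _; rewrite lee_fin.
rewrite [RHS]esum_mkcond; apply: eq_esum => i _; case: ifPn => //.
by rewrite notin_setE /= => /negP/as0->.
Qed.

(** On a finite support the positive and negative parts in [rsum] are finite sums and recombine
    termwise. *)
Lemma csum_seq (s : seq X) (f : X -> R[i]) : uniq s ->
  (forall i, i \notin s -> f i = 0) -> csum f = \sum_(i <- s) f i.
Proof.
move=> us fs0.
have rsum_seq (g : X -> R) : (forall i, i \notin s -> g i = 0) ->
    rsum g = \sum_(i <- s) g i.
  move=> gs0; rewrite /rsum !(esum_seq us) /=.
  - rewrite -sumrB; apply: eq_bigr => i _.
    by have [gi|gi] := ltP 0 (g i); rewrite /Num.max; case: ltP; case: ltP; lra.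
  - by move=> i; rewrite le_max lexx orbT.
  - by move=> i /gs0->; rewrite oppr0 maxxx.
  - by move=> i; rewrite le_max lexx orbT.
  - by move=> i /gs0->; rewrite maxxx.
rewrite /csum !rsum_seq; try by move=> i /fs0->.
have -> : \sum_(i <- s) complex.Re (f i) = complex.Re (\sum_(i <- s) f i).
  by rewrite (big_morph (@complex.Re R) (id1 := 0) (op1 := +%R)) // => -[? ?] [].
have -> : \sum_(i <- s) complex.Im (f i) = complex.Im (\sum_(i <- s) f i).
  by rewrite (big_morph (@complex.Im R) (id1 := 0) (op1 := +%R)) // => -[? ?] [].
by case: (\sum_(i <- s) f i).
Qed.

Lemma csum0 (f : X -> R[i]) : (forall i, f i = 0) -> csum f = 0.
Proof. by move=> f0; rewrite (@csum_seq [::]) ?big_nil. Qed.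

Lemma normcE (z : R[i]) : `|z| = (normc z)%:C%C.
Proof. by rewrite normc_def; case: z. Qed.

Lemma normc_real (r : R) : normc r%:C%C = `|r|.
Proof. by rewrite /= expr0n addr0 sqrtr_sqr. Qed.

Lemma normc_ge0 (z : R[i]) : 0 <= normc z.
Proof. by rewrite -lecR -normcE normr_ge0. Qed.

Lemma mulcJ_normc (z : R[i]) : z^*%C * z = (normc z ^+ 2)%:C%C.
Proof. by rewrite mulrC -sqr_normc normcE rmorphXn. Qed.

Lemma finsupp_seq (phi : wavefun R X) : finsupp phi ->
  exists2 s : seq X, uniq s & forall m, m \notin s -> phi m = 0.
Proof.
case/finite_seqP => s sE; exists (undup s); first exact: undup_uniq.
move=> m; rewrite mem_undup => ms; apply/eqP; apply: contraNT ms => phim.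
by have : [set` s] m by rewrite -sE.
Qed.

(** Turns convergence in norm into convergence of every amplitude. *)
Lemma normsq_ge (phi : wavefun R X) m : (((normc (phi m)) ^+ 2)%:E <= normsq phi)%E.
Proof.
apply: esum_ge; exists [set m]; first by split => //; exact: finite_set1.
by rewrite fsbig_set1.
Qed.

Lemma finsupp_l2 (phi : wavefun R X) : finsupp phi -> l2 phi.
Proof.
case/finsupp_seq => s us s0; rewrite /l2 /= /normsq (esum_seq us) ?ltry //.
  by move=> i; rewrite sqr_ge0.
by move=> i /s0->; rewrite normc0 expr0n.
Qed.

Lemma normsq0 : normsq (0 : wavefun R X) = 0%E.
Proof. by apply: esum1 => i _; rewrite normc0 expr0n. Qed.

End UnconditionalSums.

(** * The energy form on finitely supported states *)

Section EnergyForm.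
Import Normc.
Import numFieldNormedType.Exports.
Local Open Scope classical_set_scope.
Variables (R : realType) (L : nat) (kappa : R) (lambda : R[i]).
Hypothesis kappa_gt0 : 0 < kappa.
Implicit Types (phi psi chi : state R L) (x : 'Z_L) (m nu : config L).

Local Notation h := (energy_form L kappa lambda).

Lemma subwE phi psi m : (phi - psi) m = (phi m : R[i]) - (psi m : R[i]) :> R[i].
Proof. by []. Qed.

Lemma qopB x phi psi nu :
  qop lambda x (phi - psi) nu = qop lambda x phi nu - qop lambda x psi nu.
Proof. by rewrite /qop !subwE; ring. Qed.

(** [qop] reads [phi] at two translates of [nu]; translations are injective and there are finitely
    many sites, so the preimages of the support are finite. *)
Lemma qop_finsupp phi : finsupp phi ->
  exists2 t : seq (config L), uniq t &
    forall nu, nu \notin t -> forall x, qop lambda x phi nu = 0.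
Proof.
move=> fphi; pose A := [set m | phi m != 0].
have addI (d : config L) : injective (fun nu : config L => nu + d).
  move=> nu nu' /ffunP e; apply/ffunP => y; have := e y; rewrite !ffunE.
  exact: addIn.
have fA (d : config L) : finite_set ((fun nu : config L => nu + d) @^-1` A).
  by apply: finite_preimage => //; move=> ? ? _ _; exact: addI.
pose B := \bigcup_(x in [set: 'Z_L])
  ((fun nu : config L => nu + delta x *+ 2) @^-1` A `|`
   (fun nu : config L => nu + (delta (x - 1) + delta (x + 1))) @^-1` A).
have /finite_seqP[t tE] : finite_set B.
  by apply: bigcup_finite => // x _; rewrite finite_setU; split; exact: fA.
exists (undup t); first exact: undup_uniq.
move=> nu; rewrite mem_undup => nut x; apply/eqP; apply: contraNT nut => q0.
suff : [set` t] nu by [].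
rewrite -tE; exists x => //; rewrite /preimage /A /=.
have [e1|] := eqVneq (phi (nu + delta x *+ 2)) 0; last by left.
right; apply: contraNneq q0 => e2.
by rewrite /qop e1 -addrA e2 !mulr0 subr0.
Qed.

Lemma energy_formE (s t : seq (config L)) phi psi : uniq s -> uniq t ->
  (forall m, m \notin s -> phi m = 0) ->
  (forall nu, nu \notin t -> forall x, qop lambda x phi nu = 0) ->
  h phi psi =
    \sum_(m <- s) (electrostatic m)%:R * ((phi m)^*%C * psi m) +
    kappa%:C%C * \sum_(nu <- t) \sum_(x : 'Z_L)
      (qop lambda x phi nu)^*%C * qop lambda x psi nu.
Proof.
move=> us ut s0 t0; rewrite /energy_form (csum_seq us) ?(csum_seq ut) //.
  by move=> nu /t0 q0; rewrite big1 // => x _; rewrite q0 conjc0 mul0r.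
by move=> m /s0->; rewrite conjc0 mul0r mulr0.
Qed.

(** With common finite index sets, identities for the form can be verified term by term. *)
Lemma energy_form_common phi psi : finsupp phi -> finsupp psi ->
  exists st : seq (config L) * seq (config L),
  [/\ uniq st.1, uniq st.2,
      forall m, m \notin st.1 -> phi m = 0 /\ psi m = 0 &
      forall nu, nu \notin st.2 -> forall x,
        qop lambda x phi nu = 0 /\ qop lambda x psi nu = 0].
Proof.
move=> fphi fpsi.
have [s1 _ s1P] := finsupp_seq fphi; have [s2 _ s2P] := finsupp_seq fpsi.
have [t1 _ t1P] := qop_finsupp fphi; have [t2 _ t2P] := qop_finsupp fpsi.
exists (undup (s1 ++ s2), undup (t1 ++ t2)); split; rewrite ?undup_uniq //=.
  by move=> m; rewrite mem_undup mem_cat negb_or => /andP[/s1P-> /s2P->].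
by move=> m; rewrite mem_undup mem_cat negb_or => /andP[m1 m2] x; rewrite t1P ?t2P.
Qed.

Lemma energy_formB phi psi : finsupp phi -> finsupp psi ->
  h phi phi + h psi psi = h (phi - psi) (phi - psi) + (h phi psi + h psi phi).
Proof.
move=> fphi fpsi; have [[s t] /= [us ut sP tP]] := energy_form_common fphi fpsi.
rewrite !(@energy_formE s t) //; try by [move=> m /sP[]|move=> nu /tP + x => /(_ x)[]].
- transitivity
   (\sum_(m <- s) (electrostatic m)%:R *
       ((phi m)^*%C * phi m + (psi m)^*%C * psi m) +
    kappa%:C%C * \sum_(nu <- t) \sum_(x : 'Z_L)
      ((qop lambda x phi nu)^*%C * qop lambda x phi nu +
       (qop lambda x psi nu)^*%C * qop lambda x psi nu)).
    rewrite addrACA -mulrDr -!big_split /=; congr (_ + _ * _); apply: eq_bigr => ? _.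
      by rewrite mulrDr.
    by rewrite -big_split.
  rewrite [X in _ = _ + X]addrACA -mulrDr [RHS]addrACA -mulrDr -!big_split /=.
  congr (_ + _ * _); apply: eq_bigr => m _.
    rewrite -!mulrDr; congr (_ * _).
    by rewrite subwE rmorphB /=; ring.
  rewrite -!big_split /=; apply: eq_bigr => x _; rewrite qopB.
  by move: (qop lambda x phi m) (qop lambda x psi m) => a b; rewrite rmorphB /=; ring.
- by move=> m /sP[e1 e2]; rewrite subwE e1 e2 subr0.
- by move=> nu /tP + x => /(_ x)[e1 e2]; rewrite qopB e1 e2 subr0.
Qed.

Lemma energy_formC phi psi : finsupp phi -> finsupp psi -> h psi phi = (h phi psi)^*%C.
Proof.
move=> fphi fpsi; have [[s t] [us ut sP tP]] := energy_form_common fphi fpsi.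
rewrite (energy_formE psi us ut (fun m ms => (sP m ms).1) (fun nu nut x => (tP nu nut x).1)).
rewrite (energy_formE phi us ut (fun m ms => (sP m ms).2) (fun nu nut x => (tP nu nut x).2)).
rewrite rmorphD rmorphM /= oppr0 !rmorph_sum /=; congr (_ + _ * _); apply: eq_bigr => m _.
  by rewrite !rmorphM /= rmorph_nat conjcK [in RHS](mulrC (phi m)).
rewrite rmorph_sum; apply: eq_bigr => x _.
by rewrite rmorphM /= conjcK mulrC.
Qed.

(** The energy is a sum of nonnegative terms, so it dominates each one; small energy thus controls
    single amplitudes. *)
Lemma energy_form_diag phi : finsupp phi ->
  exists r : R, [/\ h phi phi = r%:C%C,
    forall m, (electrostatic m)%:R * normc (phi m) ^+ 2 <= r &
    forall x nu, kappa * normc (qop lambda x phi nu) ^+ 2 <= r].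
Proof.
move=> fphi; have [[s t] /= [us ut sP tP]] := energy_form_common fphi fphi.
pose u := \sum_(m <- s) (electrostatic m)%:R * normc (phi m) ^+ 2.
pose v := \sum_(nu <- t) \sum_x normc (qop lambda x phi nu) ^+ 2.
have u0 : 0 <= u by apply: sumr_ge0 => m _; rewrite mulr_ge0 ?sqr_ge0.
have v0 : 0 <= v by apply: sumr_ge0 => nu _; apply: sumr_ge0 => x _; exact: sqr_ge0.
exists (u + kappa * v); split.
- rewrite (@energy_formE s t) //; try by [move=> m /sP[]|move=> nu /tP + x => /(_ x)[]].
  rewrite rmorphD rmorphM /= !rmorph_sum /=; congr (_ + _ * _); apply: eq_bigr => m _.
    by rewrite mulcJ_normc [RHS]rmorphM /= rmorph_nat.
  by rewrite [RHS]rmorph_sum; apply: eq_bigr => x _; rewrite mulcJ_normc.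
- move=> m; apply: le_trans (_ : u <= _); last by rewrite lerDl mulr_ge0 // ltW.
  have [ms|/sP[-> _]] := boolP (m \in s); last by rewrite normc0 expr0n mulr0.
  rewrite /u (bigD1_seq m) //= lerDl; apply: sumr_ge0 => i _.
  by rewrite mulr_ge0 ?sqr_ge0.
- move=> x nu; apply: le_trans (_ : kappa * v <= _); last by rewrite lerDr.
  rewrite ler_pM2l //.
  have [nut|/tP /(_ x)[-> _]] := boolP (nu \in t); last by rewrite normc0 expr0n.
  rewrite /v (bigD1_seq nu) //= (bigD1 x) //= -addrA lerDl addr_ge0 //.
    by apply: sumr_ge0 => i _; exact: sqr_ge0.
  by apply: sumr_ge0 => i _; apply: sumr_ge0 => y _; exact: sqr_ge0.
Qed.

(* If [h] is Cauchy along [phi] and [h (phi m) (phi n) -> 0] for each m, then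
   h(phi_m, phi_m) + h(phi_n, phi_n) = h(phi_m - phi_n, phi_m - phi_n) +
   2 Re h(phi_m, phi_n) forces the energies of the [phi m] to vanish. *)
Lemma energy_form_cvg0 (phi : nat -> state R L) (e : R) : 0 < e ->
  (forall n, finsupp (phi n)) ->
  (forall e : R, 0 < e -> exists n0 : nat, forall m n : nat, (n0 <= m)%N -> (n0 <= n)%N ->
     normc (h (phi m - phi n) (phi m - phi n)) < e) ->
  (forall chi, finsupp chi ->
     normc (h chi (phi n) - inner chi 0) @[n --> \oo] --> (0 : R)) ->
  exists n0 : nat, forall n, (n0 <= n)%N -> normc (h (phi n) (phi n)) < e.
Proof.
move=> e0 fphi cauchy weak.
(* Each of the three terms, the form of the difference, the mixed term and its conjugate,
   contributes less than [e / 3]. *)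
have [n0 n0P] := cauchy _ (divr_gt0 e0 (ltr0n R 3)); exists n0 => m n0m.
(* The weak limit is tested against [phi m] itself, so [n] has to be chosen after [m]. *)
have /cvgrPdist_lt/(_ _ (divr_gt0 e0 (ltr0n R 3)))[n1 _ n1P] := weak _ (fphi m).
pose n := maxn n0 n1.
have := n1P n (leq_maxr _ _); have := n0P _ n n0m (leq_maxl _ _).
rewrite [inner _ _]csum0 ?subr0; last by move=> i; rewrite mulr0.
rewrite sub0r normrN (ger0_norm (normc_ge0 _)) => dmn hmn.
have r0 r chi : (forall mu, (electrostatic mu)%:R * normc (chi mu : R[i]) ^+ 2 <= r) -> 0 <= r.
  by move=> /(_ 0); apply: le_trans; rewrite mulr_ge0 ?sqr_ge0.
have [rm [hm /r0 rm0 _]] := energy_form_diag (fphi m).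
have [rn [hn /r0 rn0 _]] := energy_form_diag (fphi n).
have := energy_formB (fphi m) (fphi n).
rewrite (energy_formC (fphi m) (fphi n)) hm hn -rmorphD => /(congr1 (@normc R)).
rewrite !normc_real (ger0_norm rm0) ger0_norm ?addr_ge0 // => E.
have JE (z : R[i]) : normc z^*%C = normc z by case: z => a b /=; rewrite sqrrN.
have := le_normcD (h (phi m) (phi n)) (h (phi m) (phi n))^*%C.
have := le_normcD (h (phi m - phi n) (phi m - phi n))
  (h (phi m) (phi n) + (h (phi m) (phi n))^*%C).
rewrite -E JE; lra.
Qed.

End EnergyForm.

(** * Zero energy as a condition on amplitudes *)

Section GroundStates.
Import Normc.
Import numFieldNormedType.Exports.
Local Open Scope classical_set_scope.
Variables (R : realType) (L : nat) (kappa : R) (lambda : R[i]).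
Hypothesis kappa_gt0 : 0 < kappa.
Implicit Types (psi : state R L) (x : 'Z_L) (m nu : config L).

(** The ground-state condition term by term: every equation involves at most two amplitudes, so no
    limit or summability enters. *)
Definition annihilated psi :=
  (forall m, electrostatic m != 0%N -> psi m = 0) /\
  (forall x nu, qop lambda x psi nu = 0).

Lemma normc_eq0_le (z : R[i]) (K : R) :
  (forall e : R, 0 < e -> normc z <= K * e) -> z = 0.
Proof.
move=> zK; apply: eq0_normc; apply/eqP; rewrite eq_le normc_ge0 andbT.
apply/ler_addgt0Pr => e e0; rewrite add0r.
have K1 : 0 < `|K| + 1 by rewrite ltr_wpDl.
apply: le_trans (zK _ (divr_gt0 e0 K1)) _.
rewrite mulrC mulrAC ler_pdivrMr // ler_pM2l //.
by apply: le_trans (ler_norm _) _; rewrite lerDl.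
Qed.

Lemma ground_space_annihilated psi : ground_space L kappa lambda psi -> annihilated psi.
Proof.
case=> _ _ [phi [fphi cvg_phi cauchy weak]].
(* A single index at which the energy is small and all amplitudes are close to those of [psi]. *)
have near (e : R) : 0 < e -> exists n,
    [/\ finsupp (phi n), forall m, normc (phi n m - psi m : R[i]) < e
      & normc (energy_form L kappa lambda (phi n) (phi n)) < e].
  move=> e0; have [n0 n0P] := energy_form_cvg0 kappa_gt0 e0 fphi cauchy weak.
  have e2 : (0 < (e ^+ 2)%:E)%E by rewrite lte_fin exprn_gt0.
  have : \forall n \near \oo, (normsq (phi n - psi)%R < (e ^+ 2)%:E)%E.
    have U : nbhs (0 : \bar R)%E [set y : \bar R | (y < (e ^+ 2)%:E)%E].
      by apply: open_nbhs_nbhs; split => //; exact: open_ereal_lt_ereal.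
    exact: (cvg_phi _ U).
  case=> n1 _ n1P; exists (maxn n0 n1); split => //; last exact/n0P/leq_maxl.
  move=> m; have /(le_lt_trans (normsq_ge _ m)) := n1P (maxn n0 n1) (leq_maxr _ _).
  by rewrite lte_fin ltr_pXn2r // ?nnegrE ?normc_ge0 // ltW.
split.
  (* One [e] bounds the distance from [phi n m] to [psi m], the other bounds [phi n m]: its square
     is at most the energy, because the electrostatic weight is at least 1. *)
  move=> m m0; apply: (@normc_eq0_le _ 2) => e e0.
  have [|n [fn close small]] := near (Num.min e (e ^+ 2)).
    by rewrite lt_min e0 exprn_gt0.
  have [r [hr /(_ m) rm _]] := energy_form_diag lambda kappa_gt0 fn.
  have r0 : 0 <= r by apply: le_trans rm; rewrite mulr_ge0 ?sqr_ge0.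
  move: small; rewrite hr normc_real ger0_norm // lt_min => /andP[_ re2].
  have : normc (phi n m : R[i]) < e.
    rewrite -(ltr_pXn2r (ltn0Sn 1)) ?nnegrE ?normc_ge0 ?(ltW e0) //.
    apply: le_lt_trans re2; apply: le_trans rm; rewrite ler_peMl ?sqr_ge0 //.
    by rewrite ler1n lt0n.
  have := close m; rewrite lt_min => /andP[+ _].
  have := le_normcD (phi n m : R[i]) (- (phi n m - psi m : R[i])).
  rewrite normcN opprB addrC subrK; lra.
move=> x nu.
set a := csqrt_nat R ((nu x).+1 * (nu x).+2).
set b := lambda * csqrt_nat R ((nu (x - 1)).+1 * (nu (x + 1)).+1).
(* The 1 accounts for [qop] at [phi n], small by its energy; [a] and [b] weight the errors of the
   two amplitudes that [qop] reads. *)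
apply: (@normc_eq0_le _ (1 + normc a + normc b)) => e e0.
have [|n [fn close small]] := near (Num.min e (kappa * e ^+ 2)).
  by rewrite lt_min e0 mulr_gt0 ?exprn_gt0.
have [r [hr rm /(_ x nu) rq]] := energy_form_diag lambda kappa_gt0 fn.
have r0 : 0 <= r by apply: le_trans rq; rewrite mulr_ge0 ?sqr_ge0 ?ltW.
move: small; rewrite hr normc_real ger0_norm // lt_min => /andP[_ re2].
have qe : normc (qop lambda x (phi n) nu) < e.
  rewrite -(ltr_pXn2r (ltn0Sn 1)) ?nnegrE ?normc_ge0 ?(ltW e0) //.
  by rewrite -(ltr_pM2l kappa_gt0); apply: le_lt_trans re2.
have {}close m : normc (phi n m - psi m : R[i]) < e.
  by have := close m; rewrite lt_min => /andP[].
have E : qop lambda x psi nu = qop lambda x (phi n) nu +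
    - (a * (phi n (nu + delta x *+ 2) - psi (nu + delta x *+ 2) : R[i])) +
    b * (phi n (nu + delta (x - 1) + delta (x + 1)) -
         psi (nu + delta (x - 1) + delta (x + 1)) : R[i]).
  by rewrite /qop -/a -/b; ring.
rewrite E; move: a b {E} => a b; apply: le_trans (le_normcD _ _) _.
apply: le_trans (lerD (le_normcD _ _) (lexx _)) _.
rewrite normcN !normcM !mulrDl mul1r; apply: lerD; first apply: lerD; first exact: ltW.
- by apply: ler_wpM2l; rewrite ?normc_ge0 // ltW.
- by apply: ler_wpM2l; rewrite ?normc_ge0 // ltW.
Qed.

(** The constant sequence [psi] serves as approximation, and every term of the form against [psi]
    vanishes. *)
Lemma annihilated_ground_space psi :
  finsupp psi -> annihilated psi -> ground_space L kappa lambda psi.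
Proof.
move=> fpsi [psi0 q0].
have f0 : finsupp (0 : state R L).
  by apply: sub_finite_set (finite_set0 _) => m /=; rewrite eqxx.
split; [exact: finsupp_l2 | exact: finsupp_l2 |].
have h0 chi : energy_form L kappa lambda chi psi = 0.
  rewrite /energy_form !csum0 ?mulr0 ?addr0 //.
  - by move=> nu; rewrite big1 // => x _; rewrite q0 mulr0.
  - move=> m; have [->|/psi0->] := eqVneq (electrostatic m) 0%N; first by rewrite mul0r.
    by rewrite !mulr0.
exists (fun=> psi); split => //.
- by rewrite subrr normsq0; exact: cvg_cst.
- move=> e e0; exists 0%N => m n _ _.
  rewrite (_ : energy_form _ _ _ _ _ = 0) ?normc0 // subrr.
  rewrite /energy_form !csum0 ?mulr0 ?addr0 // => m'; last by rewrite !mulr0.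
  by rewrite big1 // => x _; rewrite -(subrr psi) qopB subrr mulr0.
- move=> chi fchi; rewrite h0 [inner _ _]csum0; last by move=> i; rewrite mulr0.
  by rewrite subrr normc0; exact: cvg_cst.
Qed.

End GroundStates.

(** * VMD-states *)

Section VmdStates.
Variables (R : realType) (L : nat) (lambda : R[i]).
Hypothesis L4 : (3 < L)%N.
Implicit Types (psi : state R L) (x y : 'Z_L) (m nu : config L) (T : {set placement L}).

Lemma csqrt_nat_neq0 n : csqrt_nat R n.+1 != 0.
Proof.
apply/negP => /eqP/(congr1 (@complex.Re R))/= /eqP.
by rewrite sqrtr_eq0 leNgt ltr0Sn.
Qed.

Lemma csqrt_nat1 : csqrt_nat R 1 = 1.
Proof. by rewrite /csqrt_nat sqrtr1. Qed.

Lemma electrostatic_eq0 m :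
  (electrostatic m == 0)%N = [forall x, (m x == 0) || (m (x + 1)%R == 0)]%N.
Proof.
rewrite /electrostatic sum_nat_eq0; apply: eq_forallb => x.
by rewrite muln_eq0.
Qed.

Lemma add_configE m nu y : (m + nu) y = (m y + nu y)%N.
Proof. by rewrite ffunE. Qed.

Lemma deltaE x y : delta x y = (y == x).
Proof. by rewrite ffunE. Qed.

(** Removing two particles at [x] gives the [nu] at which [q_x = 0] balances [m] against the
    configuration with the pair moved apart. The coefficient of [psi m] is nonzero, so the other
    amplitude cannot vanish. *)
Lemma annihilated_hop psi m x : annihilated lambda psi -> psi m != 0 -> (2 <= m x)%N ->
  exists2 m', psi m' != 0 &
    forall y, (m' y + (y == x).*2 = m y + ((y == (x - 1)%R) + (y == (x + 1)%R)))%N.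
Proof.
move=> [_ /(_ x) q0] psim mx.
pose nu : config L := [ffun y => (m y - (y == x).*2)%N].
have mE : nu + delta x *+ 2 = m.
  by apply/ffunP => y; rewrite mulr2n !add_configE !deltaE ffunE; case: eqP => [->|_] /=; lia.
exists (nu + delta (x - 1) + delta (x + 1)).
  have := q0 nu; rewrite /qop mE => /eqP; rewrite subr_eq0 => /eqP E.
  apply: contraNneq psim => psi0; move/eqP: E; rewrite psi0 mulr0 mulf_eq0.
  by rewrite (negPf (csqrt_nat_neq0 _)).
move=> y; rewrite !add_configE !deltaE ffunE; case: (y =P x) => [->|_] /=; lia.
Qed.

Lemma annihilated_support psi m : annihilated lambda psi -> psi m != 0 -> vmd_config m.
Proof.
move=> aP.
have adj m' x : psi m' != 0 -> (m' x == 0%N) || (m' (x + 1) == 0%N).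
  move=> psim'; have [+ _] := aP => /(_ m').
  have [/eqP|_ H] := eqVneq (electrostatic m') 0%N.
    by rewrite electrostatic_eq0 => /forallP/(_ x).
  by rewrite H ?eqxx in psim'.
have neq1 x : ((x + 1 == x) = false) * ((x - 1 == x) = false).
  have E : (x + 1 == x) = false by apply: (@addZ_neq L L4 x 1); lia.
  by split => //; rewrite -(inj_eq (addIr 1)) subrK eq_sym.
have neq2 x : ((x + 2%:R == x) = false) * ((x - 2%:R == x) = false).
  have E : (x + 2%:R == x) = false by rewrite addZ_neq //; lia.
  by split => //; rewrite -(inj_eq (addIr 2%:R)) subrK eq_sym.
(* After the hop [x - 1] and [x + 1] are occupied, so by [adj] the sites [x], [x + 2] and [x - 2]
   are empty; undoing the hop gives the claim. *)
have gap m' x : psi m' != 0 -> (2 <= m' x)%N ->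
    [/\ m' x = 2%N, m' (x + 2%:R) = 0%N & m' (x - 2%:R) = 0%N].
  move=> psim' mx; have [m2 psim2 m2E] := annihilated_hop aP psim' mx.
  have pos y : (y == x - 1) || (y == x + 1) -> (y == x) = false -> (0 < m2 y)%N.
    move=> yx Ny; have := m2E y; rewrite Ny.
    by case: (y == x - 1) yx; case: (y == x + 1) => //; lia.
  have far y : (y == x) = false -> m2 y = 0%N -> m' y = 0%N.
    by move=> Ny m2y; have := m2E y; rewrite Ny m2y; lia.
  have p1 : (0 < m2 (x + 1)%R)%N by apply: pos; rewrite ?neq1 // eqxx orbT.
  have p2 : (0 < m2 (x - 1)%R)%N by apply: pos; rewrite ?neq1 // eqxx.
  split.
  - have /orP[/eqP m2x|/eqP m2x] := adj _ x psim2; last by rewrite m2x in p1.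
    have := m2E x; rewrite m2x eqxx ![x == _]eq_sym !neq1; lia.
  - have /orP[/eqP m2x|/eqP m2x] := adj _ (x + 1) psim2; first by rewrite m2x in p1.
    by apply: far; rewrite ?neq2 // -[RHS]m2x; congr (m2 _); ring.
  - have /orP[/eqP m2x|/eqP m2x] := adj _ (x - 2%:R) psim2.
      by apply: far; rewrite ?neq2.
    by move: p2; rewrite (_ : x - 1 = x - 2%:R + 1) ?m2x //; ring.
move=> psim; apply/vmd_configP => x; rewrite /vmd_at; apply/and3P; split.
- by case: (ltnP 1 (m x)) => [/(gap _ _ psim)[-> _ _]|/leqW].
- exact: adj.
- have [mx /=|//] := eqVneq (m x) 2%N.
  have [_ -> ->] : [/\ m x = 2%N, m (x + 2%:R) = 0%N & m (x - 2%:R) = 0%N].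
    by apply: gap; rewrite ?mx.
  rewrite !eqxx /=; apply/negP => /eqP m3.
  (* With pairs at [x] and [x + 3], the hop at [x] occupies [x + 1] and leaves at least two
     particles on [x + 3], against [gap]. For [L = 4] the site [x + 3] is [x - 1] and gains a
     particle. *)
  have [m2 psim2 m2E] := @annihilated_hop psi m x aP psim ltac:(by rewrite mx).
  have := m2E (x + 3%:R); rewrite m3 addZ_neq // addn0 => E3.
  have := m2E (x + 1); rewrite neq1 eqxx /= => E1.
  have [|_ _] := @gap m2 (x + 3%:R) psim2; first by rewrite E3 leq_addr.
  rewrite (_ : x + 3%:R - 2%:R = x + 1); last by ring.
  by move: E1; case: (_ == _) => /=; lia.
Qed.

(** Next to the pair of a dimer [nu] is empty on [x - 1], [x] and [x + 1], so the square roots in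
    [q_x] reduce to those of 2 and 1. *)
Lemma qop_fuses x T T' nu psi : T' \in tilings L -> fuses (x - 1) T T' ->
  tiling_config T' = nu + delta x *+ 2 ->
  tiling_config T = nu + delta (x - 1) + delta (x + 1) /\
  qop lambda x psi nu =
    csqrt_nat R 2 * psi (tiling_config T') - lambda * psi (tiling_config T).
Proof.
move=> tT' fT eT'.
have eT'y y : tiling_config T' y = (nu y + (y == x).*2)%N.
  by rewrite eT' mulr2n !add_configE deltaE addnn.
have eT : tiling_config T = nu + delta (x - 1) + delta (x + 1).
  apply/ffunP => y; rewrite !add_configE !deltaE.
  have := fuses_config y fT; rewrite eT'y subrK.
  have -> : x - 1 + 2%:R = x + 1 by ring.
  by case: (y == x) => /=; lia.
split => //.
have /vmd_configP V := vmd_tiling_config L4 tT'.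
have nux : nu x = 0%N.
  by have /andP[+ _] := V x; rewrite eT'y eqxx; lia.
have nux1 : nu (x + 1) = 0%N.
  have /and3P[_ + _] := V x; rewrite !eT'y eqxx.
  by case: (nu (x + 1)%R) => //=; lia.
have nux2 : nu (x - 1) = 0%N.
  have /and3P[_ + _] := V (x - 1); rewrite subrK !eT'y eqxx.
  by case: (nu (x - 1)%R) => //= n; lia.
by rewrite eT' eT /qop nux nux1 nux2 csqrt_nat1 mulr1.
Qed.

Lemma annihilated_fuses psi y T T' : annihilated lambda psi -> T' \in tilings L ->
  fuses y T T' ->
  psi (tiling_config T') = lambda / csqrt_nat R 2 * psi (tiling_config T).
Proof.
move=> [_ q0] tT'; rewrite -[y](addrK 1); set x := y + 1 => fT.
have Dx : occ T' Dimer (x - 1) by have [_ _] := fT (x - 1); rewrite eqxx; case: (occ T' _ _); lia.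
have Tx : tiling_config T' x = 2%N.
  have /vmd_configP/(_ x)/andP[+ _] := vmd_tiling_config L4 tT'.
  by rewrite tiling_configE Dx; case: (occ T' Monomer x).
pose nu : config L := [ffun z => (tiling_config T' z - (z == x).*2)%N].
have eT' : tiling_config T' = nu + delta x *+ 2.
  apply/ffunP => z; rewrite mulr2n !add_configE !deltaE [nu z]ffunE.
  by case: (z =P x) => [->|_]; rewrite ?Tx ?subn0 ?addn0.
have [_] := qop_fuses psi tT' fT eT'; rewrite q0 => /esym/eqP.
rewrite subr_eq0 => /eqP E; apply: (mulfI (csqrt_nat_neq0 1)); rewrite E.
by rewrite mulrA (mulrC (csqrt_nat R 2)) divfK // csqrt_nat_neq0.
Qed.

(** Dimers are split one at a time, each contributing one factor. *)
Lemma annihilated_root_of psi T : annihilated lambda psi -> T \in tilings L ->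
  psi (tiling_config T) =
    (lambda / csqrt_nat R 2) ^+ num_dimers T * psi (tiling_config (root_of T)).
Proof.
move=> aP; have [n] := ubnP (num_dimers T); elim: n => // n IHn in T *; rewrite ltnS => dT tT.
have [rT|] := boolP (T \in root_tilings L).
  rewrite root_of_id // num_dimersE big1 ?expr0 ?mul1r // => x _.
  by have /root_tilingP[_ ->] := rT.
rewrite inE tT negb_forall_in => /exists_inP[[x t] /= xT]; rewrite negbK => /eqP et.
have fT : fuses x (split_at x T) T by apply: fuses_split_at; rewrite // /occ -et.
have tT' : split_at x T \in tilings L by rewrite -(fuses_tiling L4 fT).
rewrite (annihilated_fuses aP tT fT) (fuses_root_of fT) (fuses_num_dimers fT) exprS -[RHS]mulrA.
by rewrite IHn // -(fuses_num_dimers fT).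
Qed.

(** Distinct tilings have distinct configurations, so at most one ket of the sum contributes. *)
Lemma vmd_stateE T0 T : T0 \in root_tilings L -> T \in tilings L ->
  vmd_state lambda T0 (tiling_config T) =
    if root_of T == T0 then (lambda / csqrt_nat R 2) ^+ num_dimers T else 0.
Proof.
move=> rT0 tT; rewrite /vmd_state fct_sumE.
have ketE T' : T' \in tilings_of T0 -> 
    ((lambda / csqrt_nat R 2) ^+ num_dimers T' *: ket R (tiling_config T')) (tiling_config T)
  = (lambda / csqrt_nat R 2) ^+ num_dimers T' * (T' == T)%:R.
  rewrite mem_tilings_of // => /andP[tT' _]; rewrite /ket /=.
  by rewrite [T' == T]eq_sym -(inj_in_eq (tiling_config_inj L4)).
case: ifPn => rT.
  rewrite (bigD1 T) /=; last by rewrite mem_tilings_of // tT.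
  rewrite ketE ?mem_tilings_of ?tT // eqxx mulr1 big1 ?addr0 // => T' /andP[tT' /negPf nT].
  by rewrite ketE // nT mulr0.
rewrite big1 // => T' tT'; rewrite ketE //; move: tT'; rewrite mem_tilings_of // => /andP[_ rT'].
by case: (T' =P T) rT' => [->|_ _]; rewrite ?(negPf rT) ?mulr0.
Qed.

Lemma vmd_state_supp T0 m : T0 \in root_tilings L ->
  vmd_state lambda T0 m != 0 -> vmd_config m.
Proof.
move=> rT0; apply: contraNT => Vm; rewrite /vmd_state fct_sumE big1 // => T.
rewrite mem_tilings_of // => /andP[tT _].
have mT : (m == tiling_config T) = false.
  by apply: contraNF Vm => /eqP->; exact: vmd_tiling_config.
transitivity ((lambda / csqrt_nat R 2) ^+ num_dimers T * (m == tiling_config T)%:R) => //.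
by rewrite mT mulr0.
Qed.

Lemma electrostatic_vmd_config m : vmd_config m -> electrostatic m = 0%N.
Proof.
move=> /vmd_configP Vm; apply/eqP; rewrite electrostatic_eq0; apply/forallP => x.
by have /and3P[] := Vm x.
Qed.

Lemma vmd_state_annihilated T0 : T0 \in root_tilings L ->
  annihilated lambda (vmd_state lambda T0).
Proof.
move=> rT0; split.
  move=> m; apply: contraNeq => /(vmd_state_supp rT0)/electrostatic_vmd_config->.
  exact: eqxx.
move=> x nu; set v := vmd_state lambda T0.
(* Tilings related by a fusion have the same root, and their amplitudes differ by the factor that
   makes the two terms of [q_x] cancel. *)
have key T T' : T' \in tilings L -> fuses (x - 1) T T' ->
    tiling_config T' = nu + delta x *+ 2 -> qop lambda x v nu = 0.
  move=> tT' fT eT'; have [_ ->] := qop_fuses v tT' fT eT'.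
  rewrite /v !vmd_stateE -?(fuses_tiling L4 fT) // (fuses_root_of fT) (fuses_num_dimers fT).
  case: eqP => _; last by rewrite !mulr0 subrr.
  by rewrite exprS mulrA (mulrC (csqrt_nat R 2)) divfK ?subrr // csqrt_nat_neq0.
have vmd0 m : ~~ vmd_config m -> v m = 0.
  by move=> Vm; apply: contraNeq Vm; exact: vmd_state_supp.
(* If [q_x] reads a pair configuration of a tiling, its dimer is split; if it reads a separated one,
   its monomers are fused; otherwise both amplitudes vanish. *)
have [V1|V1] := boolP (vmd_config (nu + delta x *+ 2)).
  have tT' := tiling_ofP L4 V1; have eT' := tiling_ofK V1.
  set T' := tiling_of _ in tT' eT'.
  apply: (key (split_at (x - 1) T') T') => //; apply: fuses_split_at => //.
  rewrite /occ inE /= subrK; have /vmd_configP/(_ x)/andP[+ _] := V1.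
  by rewrite mulr2n !add_configE !deltaE eqxx; lia.
have [V2|V2] := boolP (vmd_config (nu + delta (x - 1) + delta (x + 1))); last first.
  by rewrite /qop !vmd0 // !mulr0 subrr.
set m := nu + delta (x - 1) + delta (x + 1) in V2.
have tT := tiling_ofP L4 V2; have eT := tiling_ofK V2.
set T := tiling_of m in tT eT.
have p1 : (0 < m (x - 1)%R)%N by rewrite /m !add_configE !deltaE eqxx; lia.
have p2 : (0 < m (x + 1)%R)%N by rewrite /m !add_configE !deltaE eqxx; lia.
(* Both sites [x - 1] and [x + 1] are occupied, and a pair has empty sites at distance two, so each
   carries a single particle. *)
have fT : fuses (x - 1) T (fuse_at (x - 1) T).
  apply: fuses_fuse_at => //; rewrite /occ inE /=.
    have /vmd_configP/(_ (x - 1))/and3P[m2 _] := V2.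
    have -> : x - 1 + 2%:R = x + 1 by ring.
    by case: (m (x - 1)%R) m2 p1 => [|[|[|]]] //=; case: (m (x + 1)%R) p2.
  have /vmd_configP/(_ (x + 1))/and3P[m2 _] := V2.
  have -> : x + 1 - 2%:R = x - 1 by ring.
  have -> : x - 1 + 2%:R = x + 1 by ring.
  by case: (m (x + 1)%R) m2 p2 => [|[|[|]]] //=; case: (m (x - 1)%R) p1; rewrite //= ?andbF.
have tT' : fuse_at (x - 1) T \in tilings L by rewrite (fuses_tiling L4 fT).
apply: (key _ _ tT' fT); apply/ffunP => y.
have := fuses_config y fT; rewrite eT /m subrK.
have -> : x - 1 + 2%:R = x + 1 by ring.
rewrite mulr2n !add_configE !deltaE.
rewrite addnn => E; apply: (@addIn ((y == x - 1)%R + (y == x + 1)%R)%N).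
by rewrite E -[(nu y + _ + _)%N]addnA addnAC.
Qed.

End VmdStates.

(** * Basis, orthogonality and particle number *)

Section GroundSpaceBasis.
Variables (R : realType) (L : nat) (kappa : R) (lambda : R[i]).
Hypotheses (L4 : (3 < L)%N) (kappa_gt0 : 0 < kappa).
Implicit Types (psi : state R L) (x y : 'Z_L) (m nu : config L) (T : {set placement L}).

Lemma lincombE (I : finType) (c : I -> R[i]) (v : I -> state R L) m :
  (\sum_i c i *: v i) m = \sum_i c i * (v i m : R[i]) :> R[i].
Proof. by rewrite fct_sumE. Qed.

Lemma annihilated_lincomb (I : finType) (c : I -> R[i]) (v : I -> state R L) :
  (forall i, annihilated lambda (v i)) -> annihilated lambda (\sum_i c i *: v i).
Proof.
move=> av; split=> [m m0|x nu].
  by rewrite lincombE big1 // => i _; have [/(_ m m0) -> _] := av i; rewrite mulr0.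
rewrite /qop !lincombE !mulr_sumr -sumrB big1 // => i _.
have [_ /(_ x nu) q0] := av i.
by rewrite -[RHS](mulr0 (c i)) -q0 /qop; ring.
Qed.

Lemma annihilated_finsupp psi : annihilated lambda psi -> finsupp psi.
Proof.
move=> aP; apply: (@sub_finite_set _ _ [set` map (@tiling_config L) (enum (tilings L))]).
  move=> m /= /(annihilated_support L4 aP) Vm.
  by apply/mapP; exists (tiling_of m); rewrite ?mem_enum ?tiling_ofP ?tiling_ofK.
exact: finite_seq.
Qed.

(** Any enumeration of the root tilings is allowed, so that one proof yields both the basis indexed
    by root tilings and, with ordinals, the dimension. *)
Lemma ground_space_basis (I : finType) (root : I -> {set placement L}) :
  injective root -> (forall T, reflect (exists i, T = root i) (T \in root_tilings L)) ->
  is_basis (ground_space L kappa lambda) (fun i => vmd_state lambda (root i)).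
Proof.
move=> root_inj rootP.
have rr i : root i \in root_tilings L by apply/rootP; exists i.
have tr i : root i \in tilings L by have /root_tilingP[] := rr i.
have vE i T : T \in tilings L -> vmd_state lambda (root i) (tiling_config T) =
    (root_of T == root i)%:R * (lambda / csqrt_nat R 2) ^+ num_dimers T.
  by move=> tT; rewrite vmd_stateE //; case: eqP; rewrite ?mul1r ?mul0r.
have combE (c : I -> R[i]) i T : T \in tilings L -> root_of T = root i ->
    (\sum_i c i *: vmd_state lambda (root i)) (tiling_config T) =
    c i * (lambda / csqrt_nat R 2) ^+ num_dimers T.
  move=> tT rT; rewrite lincombE (bigD1 i) //= vE // rT eqxx mul1r big1 ?addr0 // => j /negPf ji.
  by rewrite vE // rT (inj_eq root_inj) eq_sym ji mul0r mulr0.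
have d0 i : num_dimers (root i) = 0%N.
  by have /root_tilingP[_ D] := rr i; rewrite num_dimersE big1 // => x _; rewrite D.
have combE0 (c : I -> R[i]) i :
    (\sum_i c i *: vmd_state lambda (root i)) (tiling_config (root i)) = c i.
  by rewrite (combE _ i) ?root_of_id // d0 expr0 mulr1.
split=> [c c0 i|u]; first by rewrite -(combE0 c i) c0.
split=> [/(ground_space_annihilated kappa_gt0) au|[c ->]]; last first.
  apply: annihilated_ground_space.
    by apply: annihilated_finsupp; apply: annihilated_lincomb => i; exact: vmd_state_annihilated.
  by apply: annihilated_lincomb => i; exact: vmd_state_annihilated.
(* At a root configuration only its own VMD-state is nonzero, with value 1, so the amplitudes there
   are the only possible coefficients. *)
exists (fun i => u (tiling_config (root i))); apply/funext => m.
have [Vm|Vm] := boolP (vmd_config m); last first.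
  rewrite lincombE big1 => [|i _].
    by apply: contraNeq Vm; exact: (annihilated_support L4 au).
  suff -> : vmd_state lambda (root i) m = 0 by rewrite mulr0.
  by apply: contraNeq Vm; exact: (vmd_state_supp L4).
have tT := tiling_ofP L4 Vm; rewrite -(tiling_ofK Vm); set T := tiling_of m in tT *.
have /rootP[i rT] := root_of_root L4 tT.
by rewrite (combE _ i) // (annihilated_root_of L4 au tT) rT mulrC.
Qed.

(** The supports are disjoint: a configuration determines its tiling, which has a single root. *)
Lemma vmd_state_orthogonal T T' : T \in root_tilings L -> T' \in root_tilings L ->
  T != T' -> inner (vmd_state lambda T) (vmd_state lambda T') = 0.
Proof.
move=> rT rT' TT'; apply: csum0 => m.
have [->|vm] := eqVneq (vmd_state lambda T m) 0; first by rewrite conjc0 mul0r.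
have Vm := vmd_state_supp L4 rT vm; move: vm.
rewrite -(tiling_ofK Vm) !vmd_stateE ?tiling_ofP //.
case: (_ =P T) => [->|]; last by rewrite eqxx.
by rewrite (negPf TT') mulr0.
Qed.

(** Splitting dimers preserves the particle number, so it is constant on the support. *)
Lemma number_op_vmd_state T : T \in root_tilings L ->
  number_op (vmd_state lambda T) = ((num_particles T)%:R : R[i]) *: vmd_state lambda T.
Proof.
move=> rT; apply/funext => m; rewrite /number_op fct_sumE.
transitivity ((\sum_x m x)%:R * (vmd_state lambda T m : R[i])).
  by rewrite natr_sum mulr_suml.
rewrite [RHS](_ : _ = (num_particles T)%:R * (vmd_state lambda T m : R[i])) //.
have [->|vm] := eqVneq (vmd_state lambda T m) 0; first by rewrite !mulr0.
congr (_%:R * _); have Vm := vmd_state_supp L4 rT vm; move: vm.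
have tm := tiling_ofP L4 Vm.
rewrite -{1 2}(tiling_ofK Vm) vmd_stateE //; case: (_ =P T) => [<- _|]; last by rewrite eqxx.
by rewrite num_particles_root_of.
Qed.

End GroundSpaceBasis.

Theorem theorem2p6 (R : realType) (kappa : R) (lambda : R[i])
    (kappa_gt0 : 0 < kappa) (lambda_neq0 : lambda != 0) :
  (forall (a b : int) (L : nat), L%:Z = b - a + 1 -> (4 <= L)%N ->
     is_basis (ground_space L kappa lambda)
       (fun T : {T : {set placement L} | T \in root_tilings L} =>
          vmd_state lambda (val T))
     /\
     (forall T T' : {set placement L},
        T \in root_tilings L -> T' \in root_tilings L -> T != T' ->
        inner (vmd_state lambda T) (vmd_state lambda T') = 0))
  /\
  (exists c C : R, [/\ 0 < c, 0 < C &
     forall (a b : int) (L : nat), L%:Z = b - a + 1 -> (4 <= L)%N ->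
     exists n : nat,
       has_dim (ground_space L kappa lambda) n /\
       c * golden R ^+ L <= n%:R <= C * golden R ^+ L])
  /\
  (forall (a b : int) (L : nat), L%:Z = b - a + 1 -> (4 <= L)%N ->
     (forall T : {set placement L}, T \in root_tilings L ->
        number_op (vmd_state lambda T)
        = ((num_particles T)%:R : R[i]) *: vmd_state lambda T)
     /\
     (2^-1 : R) - (2 * L%:R)^-1
       <= \big[Num.max/(0 : R)]_(T in root_tilings L)
            ((num_particles T)%:R / L%:R)
       <= 2^-1).
Proof.
split; [|split].
- move=> _ _ L _ L4; split; last by move=> T T'; exact: vmd_state_orthogonal.
  apply: ground_space_basis => // T; apply: (iffP idP) => [rT|[[T' rT'] ->] //].
  by exists (exist _ T rT).
- have phi_gt0 : 0 < golden R by apply: lt_trans (golden_gt1 R).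
  (* The lower bound comes from words of length [L - 1], which loses a factor; the upper one from
     words of length [L], bounded by the next power. *)
  exists (golden R)^-1, (golden R); split; rewrite ?invr_gt0 // => _ _ L _ L4.
  exists #|root_tilings L|; split.
    exists (fun i => vmd_state lambda (enum_val i)).
    apply: ground_space_basis => //; first by move=> i j /enum_val_inj.
    move=> T; apply: (iffP idP) => [rT|[i ->]]; last exact: enum_valP.
    by exists (enum_rank_in rT T); rewrite enum_rankK_in.
  have /andP[low _] := size_sparse_words_bounds R L.-1.
  have /andP[_ up] := size_sparse_words_bounds R L.
  apply/andP; split.
    apply: le_trans (_ : (size (sparse_words L.-1))%:R <= _); last first.
      by rewrite ler_nat card_root_tilings_ge.
    apply: le_trans low; rewrite -{1}(prednK (ltn_trans _ L4)) // exprS mulKf //.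
    by rewrite gt_eqF.
  by rewrite -exprS; apply: le_trans up; rewrite ler_nat card_root_tilings_le.
- move=> _ _ L _ L4; split; first by move=> T; exact: number_op_vmd_state.
  have L0 : 0 < L%:R :> R by rewrite ltr0n; lia.
  apply/andP; split.
    (* The density of this tiling is 1/2 for even [L] and exactly the lower bound for odd [L]. *)
    have [T rT nT] := packed_root_tiling L4.
    apply: le_trans (_ : (num_particles T)%:R / L%:R <= _).
      rewrite ler_pdivlMr // mulrBl invfM -mulrA mulVf ?gt_eqF // mulr1 nT.
      have : (L%:R : R) = (odd L)%:R + (L./2)%:R * 2.
        by rewrite -natrM muln2 -natrD odd_double_half.
      by case: (odd L) => /=; lra.
    exact: (le_bigmax_cond _ (fun T => (num_particles T)%:R / L%:R)).
  (* The maximum starts from the default value 0, which the bound must dominate as well. *)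
  apply/bigmax_leP; split; first by rewrite invr_ge0.
  move=> T rT; rewrite ler_pdivrMr // mulrC ler_pdivlMr // -natrM ler_nat muln2.
  exact: num_particles_le.
Qed.
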